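(* Let $f:\mathbb{R}^d\to\mathbb{R}$ be continuously differentiable with $L$-Lipschitz continuous gradient ($L>0$) and bounded from below. Let $b>0$, let $x_0,p_0\in\mathbb{R}^d$, let $(a_n)_{n\ge 0}$ be a sequence of vectors of $\mathbb{R}^d$ with positive coordinates, and let $(x_n),(p_n)$ be generated by $$p_{n+1}=p_n+b(\nabla f(x_n)-p_n),\qquad x_{n+1}=x_n-a_{n+1}p_{n+1},\qquad n\ge 0.$$ Put $H_n=f(x_n)+\frac{1}{2b}\langle a_n,p_n^2\rangle$. Let $\alpha>0$ be such that $a_{n+1}\le a_n/\alpha$ for all $n\in\mathbb{N}$, and suppose $1-\alpha<b\le 1$. Let $\varepsilon>0$ be such that $$a_{\sup}:=\frac{2}{L}\left(1-\frac{(b-(1-\alpha))^2}{2b\alpha}-\frac{1-\alpha}{2b}-\varepsilon\right)$$ is nonnegative. Let $\delta>0$ be such that for all $n\in\mathbb{N}$, $$\delta\le a_{n+1}\le\min\left(a_{\sup},\frac{a_n}{\alpha}\right).$$ Then the sequence $(H_n)$ is nonincreasing and $\sum_n\|p_n\|^2<\infty$. In particular, $x_{n+1}-x_n\to 0$ and $\nabla f(x_n)\to 0$ as $n\to+\infty$. Moreover, for all $n\ge 1$, $$\min_{0\le k\le n-1}\|\nabla f(x_k)\|^2\le\frac{4}{nb^2}\left(\frac{H_0-\inf f}{\delta\varepsilon}+\|p_0\|^2\right).$$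
   Context: All operations and inequalities between vectors of $\mathbb{R}^d$ are coordinatewise: $xy$, $x/y$, $x^2$, $\min$ are taken coordinate by coordinate, $x\le y$ means that every coordinate of $x$ is at most the corresponding coordinate of $y$, and for a scalar $\lambda$, $x\le\lambda$ (resp. $\lambda\le x$) means that every coordinate of $x$ is at most (resp. at least) $\lambda$. $\langle\cdot,\cdot\rangle$ and $\|\cdot\|$ are the Euclidean inner product and norm. The step sizes $a_n$ are arbitrary vectors (they may depend on past iterates and gradients). *)

(* Defs.v *)
From HB Require Import structures.
From mathcomp Require Import all_boot all_order all_algebra.
From mathcomp Require Import all_classical all_reals.
From mathcomp Require Import topology normedtype sequences derive.
Set Implicit Arguments.
Unset Strict Implicit.
Unset Printing Implicit Defensive.
Import Order.TTheory GRing.Theory Num.Theory.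
Import numFieldNormedType.Exports.
Local Open Scope ring_scope.
Local Open Scope classical_set_scope.

(* Vectors of R^d are row vectors 'rV[R]_d.  The library norm `|u| on 'rV[R]_d
   is the sup norm, so the Euclidean norm is defined separately; the topology
   of 'rV[R]_d is the usual one. *)
Section Vectors.
Context {R : realType} {d : nat}.
Implicit Types u v : 'rV[R]_d.

Definition vmul u v : 'rV[R]_d := map2_mx *%R u v.

Definition vmin u v : 'rV[R]_d := map2_mx Num.min u v.

Definition vle u v : Prop := forall i, u 0 i <= v 0 i.

Definition vlt u v : Prop := forall i, u 0 i < v 0 i.

Definition dot u v : R := \sum_(i < d) u 0 i * v 0 i.

Definition enorm u : R := Num.sqrt (dot u u).

Definition grad (f : 'rV[R]_d -> R) (x : 'rV[R]_d) : 'rV[R]_d :=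
  \row_(i < d) 'D_(delta_mx 0 i) f x.

Definition continuously_differentiable (f : 'rV[R]_d -> R) : Prop :=
  (forall x, differentiable f x) /\ continuous (grad f).

Definition lipschitz_gradient (L : R) (f : 'rV[R]_d -> R) : Prop :=
  forall x y, enorm (grad f x - grad f y) <= L * enorm (x - y).

Definition energy (f : 'rV[R]_d -> R) (b : R) (a x p : nat -> 'rV[R]_d)
    (n : nat) : R :=
  f (x n) + 1 / (2 * b) * dot (a n) (vmul (p n) (p n)).

End Vectors.

Definition step_sup {R : realType} (L b alpha eps : R) : R :=
  2 / L * (1 - (b - (1 - alpha)) ^+ 2 / (2 * b * alpha)
             - (1 - alpha) / (2 * b) - eps).

(* Main.v *)
Require Import Defs.
From HB Require Import structures.
From mathcomp Require Import all_boot all_order all_algebra.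
From mathcomp Require Import all_classical all_reals.
From mathcomp Require Import topology normedtype sequences derive.
From mathcomp Require Import ring lra.
Set Implicit Arguments.
Unset Strict Implicit.
Unset Printing Implicit Defensive.
Import Order.TTheory GRing.Theory Num.Theory.
Import numFieldNormedType.Exports.
Local Open Scope ring_scope.
Local Open Scope classical_set_scope.

(** Write [p], [q] for two consecutive momenta, [a], [A] for the matching step
    sizes and [g] for the gradient at the current point, so that
    [g = (q - (1 - b) p) / b] and the point moves by [- A q]. The descent lemma
    for a function with Lipschitz gradient bounds the change of [f] by
    [- <g, A q> + (L / 2) |A q|^2]. Substituting [g] and adding the change of
    the momentum term of the energy gives a sum over the coordinates of
    quadratic forms in [(p, q)]; the bound [step_sup] on [A] is the threshold
    at which, after completing the square in [p], each of these forms is at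
    most [- eps A q^2]. Hence a step lowers the energy by at least
    [delta eps |q|^2] ([energy_decrease]).

    The energy dominates [f], hence [inf f], so telescoping bounds the sum of
    the squared norms of [p 1, p 2, ...] by
    [(H_0 - inf f) / (delta eps)]. All the conclusions follow: the displacement
    [- A q] is bounded by [step_sup] times [q], and the gradient is a
    combination of [p] and [q] with
    [b^2 |g|^2 <= 2 |q|^2 + 2 |p|^2] ([grad_le_momenta]). Summing the latter
    over the first [n] steps counts each momentum at most twice, which gives
    the factor 4 of the rate for the smallest gradient. *)

(** * Euclidean inner product *)

Section Euclidean.
Context {R : realType} {d : nat}.
Implicit Types (u v w : 'rV[R]_d) (c : R).

Lemma dotC u v : dot u v = dot v u.
Proof. by apply: eq_bigr => i _; rewrite mulrC. Qed.

Lemma dotDl u v w : dot (u + v) w = dot u w + dot v w.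
Proof. by rewrite -big_split; apply: eq_bigr => i _; rewrite mxE mulrDl. Qed.

Lemma dotZl c u v : dot (c *: u) v = c * dot u v.
Proof. by rewrite mulr_sumr; apply: eq_bigr => i _; rewrite mxE mulrA. Qed.

Lemma dotBl u v w : dot (u - v) w = dot u w - dot v w.
Proof. by rewrite dotDl -scaleN1r dotZl mulN1r. Qed.

Lemma dotZr c u v : dot u (c *: v) = c * dot u v.
Proof. by rewrite dotC dotZl dotC. Qed.

Lemma dot_ge0 u : 0 <= dot u u.
Proof. by apply: sumr_ge0 => i _; rewrite -expr2 sqr_ge0. Qed.

Lemma enorm_sqr u : enorm u ^+ 2 = dot u u.
Proof. exact/sqr_sqrtr/dot_ge0. Qed.

Lemma enorm_ge0 u : 0 <= enorm u.
Proof. exact: sqrtr_ge0. Qed.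

Lemma enormZ c u : 0 <= c -> enorm (c *: u) = c * enorm u.
Proof.
move=> c0; rewrite /enorm dotZl dotZr mulrA -expr2 sqrtrM ?sqr_ge0//.
by rewrite sqrtr_sqr ger0_norm.
Qed.

(** Cauchy-Schwarz followed by the hypothesis would give this; directly, it is
    the expansion of [|u - c v|^2 >= 0]. *)
Lemma dot_le_of_enorm_le c u v :
  0 < c -> enorm u <= c * enorm v -> dot u v <= c * dot v v.
Proof.
move=> c0 uv.
have : enorm u ^+ 2 <= (c * enorm v) ^+ 2.
  by rewrite ler_sqr ?nnegrE ?mulr_ge0 ?enorm_ge0 ?(ltW c0).
rewrite exprMn !enorm_sqr => {}uv.
have := dot_ge0 (u - c *: v).
rewrite dotBl ![dot _ (u - _)]dotC !dotBl !dotZl !dotZr (dotC v u) => sq.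
rewrite -(ler_pM2l c0); lra.
Qed.

(** Here [`|u|] is the sup norm, from which the topology comes. *)
Lemma sqr_norm_le_dot u : `|u| ^+ 2 <= dot u u.
Proof.
have [u0|u0] := eqVneq (mx_norm u) 0.
  by rewrite [`|u|]u0 expr0n dot_ge0.
have [[i j] /= uij] := mx_norm_neq0 u0.
rewrite [`|u|]uij real_normK ?num_real// ord1 /dot (bigD1 j)//= -expr2 lerDl.
by apply: sumr_ge0 => k _; rewrite -expr2 sqr_ge0.
Qed.

Lemma cvg0_of_dot (u_ : nat -> 'rV[R]_d) :
  (fun n => dot (u_ n) (u_ n)) @ \oo --> (0 : R) -> u_ @ \oo --> (0 : 'rV[R]_d).
Proof.
move=> /cvgr0Pnorm_lt u0; apply/cvgr0Pnorm_lt => e e0.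
have := u0 _ (exprn_gt0 2 e0); apply: filterS => n.
rewrite ger0_norm ?dot_ge0// => ue.
rewrite -[_ < e]ltr_sqr ?nnegrE ?(ltW e0)//.
exact: le_lt_trans (sqr_norm_le_dot _) ue.
Qed.

End Euclidean.

(** * Functions with Lipschitz gradient *)

Section Descent.
Context {R : realType} {d : nat}.
Implicit Types (f : 'rV[R]_d -> R) (x h : 'rV[R]_d).

Lemma derive_dot_grad f x h : differentiable f x -> 'D_h f x = dot (grad f x) h.
Proof.
move=> fx; rewrite deriveE// {1}[h]row_sum_delta linear_sum.
by apply: eq_bigr => i _; rewrite linearZ /= mxE deriveE// mulrC.
Qed.

(** The difference quotients are those of the directional derivative of [f]
    along [h], so no chain rule is involved. *)
Lemma is_derive_along f x h (t : R) : differentiable f (x + t *: h) ->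
  is_derive t 1 (fun s : R => f (x + s *: h)) (dot (grad f (x + t *: h)) h).
Proof.
move=> fx; rewrite -derive_dot_grad//.
have := diff_derivable (v := h) fx; rewrite /derivable /derive => fh.
have E : (fun s : R => s^-1 *: (f (s *: h + (x + t *: h)) - f (x + t *: h)))
  = (fun s : R => s^-1 *: (f (x + (s *: 1 + t) *: h) - f (x + t *: h))).
  by apply/funext => s; rewrite -[s *: 1]/(s * 1) mulr1 scalerDl addrCA.
by split; rewrite /derivable /derive /= -?E.
Qed.

(** Descent lemma. The function
      [s |-> f (x + s h) - s <grad f x, h> - s^2 (L / 2) |h|^2]
    has derivative [<grad f (x + s h) - grad f x, h> - s L |h|^2], which the
    Lipschitz bound makes nonpositive for [s > 0]; compare [s = 0] and [s = 1]. *)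
Lemma descent f (L : R) x h : (forall y, differentiable f y) -> 0 < L ->
  lipschitz_gradient L f ->
  f (x + h) <= f x + dot (grad f x) h + L / 2 * dot h h.
Proof.
move=> df L0 lip.
pose phi (s : R) := f (x + s *: h)
  - (s * dot (grad f x) h + s ^+ 2 * (L / 2 * dot h h)).
pose dphi (s : R) := dot (grad f (x + s *: h)) h
  - (dot (grad f x) h + s * (L * dot h h)).
have dphiP (s : R) : is_derive s (1 : R) phi (dphi s).
  have d1 := is_derive_along (df (x + s *: h)).
  apply: is_derive_eq.
  rewrite /dphi; congr (_ - _).
  by rewrite -![_ *: _]/(_ * _) !mulr0 !mulr1 !add0r; field.
have phi10 : phi 1 <= phi 0.
  apply: (@ler0_derive1_le_cc _ phi 0 1);
    rewrite ?in_itv/= ?lexx ?ler01//.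
  - move=> s; rewrite in_itv/= => /andP[s0 _]; rewrite derive1E derive_val /dphi.
    have : dot (grad f (x + s *: h) - grad f x) h <= L * s * dot h h.
      apply: dot_le_of_enorm_le; first exact: mulr_gt0.
      rewrite -mulrA -enormZ ?(ltW s0)//.
      by apply: le_trans (lip _ _) _; rewrite addrAC subrr add0r.
    rewrite dotBl; lra.
  - apply: continuous_subspaceT => s.
    by apply: differentiable_continuous; apply/derivable1_diffP.
move: phi10; rewrite /phi scale1r scale0r addr0; lra.
Qed.

End Descent.

(** * Energy decrease along one step *)

Section EnergyDecrease.
Context {R : realType}.

(** One coordinate of the energy balance of a step with momentum [p], new
    momentum [q], step sizes [a] then [A], and gradient [(q - (1 - b) p) / b].
    The value of [step_sup] makes the difference of the two sides a sum of
    three nonnegative terms: the slack of [alpha A <= a], the slack of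
    [A <= step_sup], and a square in [p] and [q]. *)
Lemma coordinate_balance (L b alpha eps a A p q : R) :
  0 < L -> 0 < b -> 0 < alpha -> 0 <= A ->
  A <= step_sup L b alpha eps -> A <= alpha^-1 * a ->
  (q - (1 - b) * p) / b * - (A * q) + L / 2 * (A * q) ^+ 2
    + 1 / (2 * b) * (A * q ^+ 2) + eps * (A * q ^+ 2)
  <= 1 / (2 * b) * (a * p ^+ 2).
Proof.
move=> L0 b0 al0 A0 Asup Aa.
have Aa0 : 0 <= a - alpha * A by rewrite subr_ge0 -ler_pdivlMl.
rewrite -subr_ge0.
have -> : 1 / (2 * b) * (a * p ^+ 2) - ((q - (1 - b) * p) / b * - (A * q)
    + L / 2 * (A * q) ^+ 2 + 1 / (2 * b) * (A * q ^+ 2) + eps * (A * q ^+ 2))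
  = 1 / (2 * b) * ((a - alpha * A) * p ^+ 2)
    + L / 2 * (A * q ^+ 2 * (step_sup L b alpha eps - A))
    + A / (2 * b * alpha) * ((1 - b) * q - alpha * p) ^+ 2.
  by rewrite /step_sup; field; rewrite ?gt_eqF.
have [[L0' b0'] al0'] := (ltW L0, ltW b0, ltW al0).
have Asup0 : 0 <= step_sup L b alpha eps - A by rewrite subr_ge0.
by rewrite !addr_ge0// ?(sqr_ge0, mulr_ge0, invr_ge0, ler01, ler0n).
Qed.

Lemma energy_decrease (d : nat) (f : 'rV[R]_d -> R) (L b alpha eps delta : R)
    (a x p : nat -> 'rV[R]_d) (n : nat) :
  (forall y, differentiable f y) -> 0 < L -> lipschitz_gradient L f ->
  0 < b -> 0 < alpha -> 0 < eps -> 0 < delta ->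
  p n.+1 = p n + b *: (grad f (x n) - p n) ->
  x n.+1 = x n - vmul (a n.+1) (p n.+1) ->
  vle (const_mx delta) (a n.+1) ->
  vle (a n.+1)
    (vmin (const_mx (step_sup L b alpha eps)) (alpha^-1 *: a n)) ->
  energy f b a x p n.+1 + delta * eps * dot (p n.+1) (p n.+1)
    <= energy f b a x p n.
Proof.
move=> df L0 lip b0 al0 e0 de0 pE xE alow aup; rewrite /energy xE.
have := descent (x n) (- vmul (a n.+1) (p n.+1)) df L0 lip.
suff : dot (grad f (x n)) (- vmul (a n.+1) (p n.+1))
    + L / 2 * dot (- vmul (a n.+1) (p n.+1)) (- vmul (a n.+1) (p n.+1))
    + 1 / (2 * b) * dot (a n.+1) (vmul (p n.+1) (p n.+1))
    + delta * eps * dot (p n.+1) (p n.+1)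
  <= 1 / (2 * b) * dot (a n) (vmul (p n) (p n)) by lra.
rewrite /dot !mulr_sumr -!big_split/=; apply: ler_sum => i _.
have := alow i; have := aup i; rewrite !mxE le_min => /andP[Asup Aa] Adel.
have gE : grad f (x n) 0 i = (p n.+1 0 i - (1 - b) * p n 0 i) / b.
  by rewrite pE !mxE; field; rewrite gt_eqF.
move: gE; rewrite mxE => ->.
have A0 := le_trans (ltW de0) Adel.
have := coordinate_balance (p n 0 i) (p n.+1 0 i) L0 b0 al0 A0 Asup Aa.
have : delta * eps * (p n.+1 0 i) ^+ 2 <= eps * (a n.+1 0 i * p n.+1 0 i ^+ 2).
  by rewrite mulrAC [delta * _]mulrC -mulrA [_ * eps]mulrC mulrCA ler_pM2l//
    mulrC ler_wpM2r ?sqr_ge0.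
lra.
Qed.

(** Since the gradient is recovered from two consecutive momenta as
    [(q - (1 - b) p) / b], its size is controlled by theirs. *)
Lemma grad_le_momenta (d : nat) (b : R) (g p q : 'rV[R]_d) :
  0 < b -> b <= 1 -> q = p + b *: (g - p) ->
  b ^+ 2 * dot g g <= 2 * dot q q + 2 * dot p p.
Proof.
move=> b0 b1 ->; rewrite /dot !mulr_sumr -big_split/=; apply: ler_sum => i _.
rewrite !mxE; set s := p 0 i; set r := g 0 i.
(* With [X = b r + (1 - b) s], a coordinate of the new momentum,
   [2 X^2 - (b r)^2] is completed to a square in [b r]. *)
rewrite -subr_ge0.
have -> : 2 * ((s + b * (r - s)) * (s + b * (r - s))) + 2 * (s * s)
    - b ^+ 2 * (r * r)
  = (b * r + 2 * (1 - b) * s) ^+ 2 + 2 * (1 - (1 - b) ^+ 2) * s ^+ 2 by ring.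
rewrite addr_ge0 ?sqr_ge0// mulr_ge0 ?sqr_ge0//; nra.
Qed.

(** The default value [u 0] of the minimum matters only for [n = 0], where both
    sides vanish. *)
Lemma bigmin_le_mean (u : nat -> R) (n : nat) :
  n%:R * \big[Num.min/u 0%N]_(0 <= k < n) u k <= \sum_(0 <= k < n) u k.
Proof.
rewrite mulr_natl -[n in _ *+ n]subn0 -sumr_const_nat big_nat [leRHS]big_nat.
apply: ler_sum => k /andP[_ kn].
by apply: ge_bigmin_seq; rewrite ?mem_index_iota.
Qed.

End EnergyDecrease.

(** * Convergence and rate *)

Theorem theorem2 (R : realType) (d : nat) (f : 'rV[R]_d -> R) (L b : R)
  (a x p : nat -> 'rV[R]_d) (alpha eps delta : R)
  (f_C1 : continuously_differentiable f)
  (L_gt0 : 0 < L)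
  (f_lip : lipschitz_gradient L f)
  (f_lb : has_lbound (range f))
  (b_gt0 : 0 < b)
  (a_gt0 : forall n, vlt 0 (a n))
  (p_rec : forall n, p n.+1 = p n + b *: (grad f (x n) - p n))
  (x_rec : forall n, x n.+1 = x n - vmul (a n.+1) (p n.+1))
  (alpha_gt0 : 0 < alpha)
  (a_decr : forall n, vle (a n.+1) (alpha^-1 *: a n))
  (b_lower : 1 - alpha < b)
  (b_upper : b <= 1)
  (eps_gt0 : 0 < eps)
  (step_sup_ge0 : 0 <= step_sup L b alpha eps)
  (delta_gt0 : 0 < delta)
  (a_lower : forall n, vle (const_mx delta) (a n.+1))
  (a_upper : forall n, vle (a n.+1)
     (vmin (const_mx (step_sup L b alpha eps)) (alpha^-1 *: a n))) :
  [/\ nonincreasing_seq (energy f b a x p),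
      cvgn (series (fun n => enorm (p n) ^+ 2)),
      (fun n => x n.+1 - x n) @ \oo --> (0 : 'rV[R]_d),
      (fun n => grad f (x n)) @ \oo --> (0 : 'rV[R]_d) &
      forall n, (1 <= n)%N ->
        \big[Num.min/enorm (grad f (x 0%N)) ^+ 2]_(0 <= k < n)
            enorm (grad f (x k)) ^+ 2
        <= 4 / (n%:R * b ^+ 2)
           * ((energy f b a x p 0%N - inf (range f)) / (delta * eps)
              + enorm (p 0%N) ^+ 2)].
Proof.
have [df _] := f_C1.
set E := energy f b a x p.
pose S (n : nat) := \sum_(0 <= k < n) dot (p k.+1) (p k.+1).
pose M := (E 0%N - inf (range f)) / (delta * eps).
have de0 : 0 < delta * eps by exact: mulr_gt0.
have dec n : E n.+1 + delta * eps * dot (p n.+1) (p n.+1) <= E n.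
  exact: (energy_decrease df L_gt0 f_lip b_gt0 alpha_gt0 eps_gt0 delta_gt0
    (p_rec n) (x_rec n) (a_lower n) (a_upper n)).
have E_ge n : inf (range f) <= E n.
  apply: (@le_trans _ _ (f (x n))); first by apply: ge_inf => //; exists (x n).
  rewrite lerDl mulr_ge0 ?divr_ge0 ?mulr_ge0 ?(ltW b_gt0)//.
  apply: sumr_ge0 => i _; rewrite mxE -expr2 mulr_ge0 ?sqr_ge0//.
  by have := a_gt0 n i; rewrite mxE => /ltW.
have S_le n : S n <= M.
  rewrite ler_pdivlMr// mulrC.
  suff : E n + delta * eps * S n <= E 0%N by have := E_ge n; lra.
  elim: n => [|n IHn]; first by rewrite /S big_geq// mulr0 addr0.
  by apply: le_trans IHn; rewrite /S big_nat_recr//= mulrDr; have := dec n; lra.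
have dec0 n : 0 <= delta * eps * dot (p n.+1) (p n.+1).
  by rewrite mulr_ge0 ?dot_ge0 ?(ltW de0).
have p_sum n : \sum_(0 <= k < n) dot (p k) (p k) <= M + dot (p 0%N) (p 0%N).
  apply: (@le_trans _ _ (\sum_(0 <= k < n.+1) dot (p k) (p k))).
    by rewrite big_nat_recr//= lerDl dot_ge0.
  by rewrite big_nat_recl// addrC lerD2r; exact: S_le.
have p_cvg : cvgn (series (fun n => enorm (p n) ^+ 2)).
  under eq_fun do rewrite enorm_sqr.
  apply: nondecreasing_is_cvgn.
    by apply: nondecreasing_series => n _ _; exact: dot_ge0.
  by exists (M + dot (p 0%N) (p 0%N)) => _ [n _ <-]; exact: p_sum.
have p0 : (fun n => dot (p n) (p n)) @ \oo --> (0 : R).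
  by have := cvg_series_cvg_0 p_cvg; under eq_fun do rewrite enorm_sqr.
have pS0 : (fun n => dot (p n.+1) (p n.+1)) @ \oo --> (0 : R).
  by move: p0; rewrite -cvg_shiftS.
have g_le n := grad_le_momenta b_gt0 b_upper (p_rec n).
have b2 : 0 < b ^+ 2 by exact: exprn_gt0.
split => //.
- by apply/nonincreasing_seqP => n; have := dec n; have := dec0 n; lra.
- apply: cvg0_of_dot.
  apply: (@squeeze_cvgr _ _ _ _ (cst 0)
    (fun n => step_sup L b alpha eps ^+ 2 * dot (p n.+1) (p n.+1))).
  + apply: nearW => n; rewrite dot_ge0 mulr_sumr /=; apply: ler_sum => i _.
    have -> : (x n.+1 - x n) 0 i = - (a n.+1 0 i * p n.+1 0 i).
      by rewrite x_rec !mxE; ring.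
    have := a_upper n i; rewrite !mxE le_min => /andP[Asup _].
    have := a_gt0 n.+1 i; rewrite mxE => A0.
    rewrite mulrNN -!expr2 exprMn ler_wpM2r ?sqr_ge0//.
    by rewrite ler_sqr ?nnegrE// ltW.
  + exact: cvg_cst.
  + rewrite -[X in _ --> X](mulr0 (step_sup L b alpha eps ^+ 2)).
    exact: cvgMl_tmp.
- apply: cvg0_of_dot.
  apply: (@squeeze_cvgr _ _ _ _ (cst 0)
    (fun n => (b ^+ 2)^-1 * (2 * dot (p n.+1) (p n.+1) + 2 * dot (p n) (p n)))).
  + by apply: nearW => n; rewrite dot_ge0 ler_pdivlMl//=; exact: g_le.
  + exact: cvg_cst.
  + rewrite -[X in _ --> X](mulr0 (b ^+ 2)^-1); apply: cvgMl_tmp.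
    rewrite -[X in _ --> X](addr0 0) -{1}(mulr0 2) -{2}(mulr0 2).
    by apply: cvgD; exact: cvgMl_tmp.
- move=> n n1; have n0 : 0 < n%:R :> R by rewrite ltr0n.
  rewrite -/M enorm_sqr mulrAC ler_pdivlMr ?mulr_gt0// mulrCA mulrC.
  have := bigmin_le_mean (fun k => enorm (grad f (x k)) ^+ 2) n.
  rewrite /= enorm_sqr -(ler_pM2l b2).
  set m := \big[_/_]_(_ <= _ < _) _ => m_le.
  have : b ^+ 2 * \sum_(0 <= k < n) enorm (grad f (x k)) ^+ 2
      <= 2 * S n + 2 * \sum_(0 <= k < n) dot (p k) (p k).
    rewrite !mulr_sumr -big_split/=; apply: ler_sum => k _.
    by rewrite enorm_sqr; exact: g_le.
  have := S_le n; have := p_sum n; rewrite !enorm_sqr.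
  (* [b^2 n m <= 2 M + 2 (M + |p 0|^2)], which is at most [4 (M + |p 0|^2)]. *)
  have := dot_ge0 (p 0%N); lra.
Qed.
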